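(* Let $p,q$ be co-prime positive integers, let $N\ge 2$ be an integer, let $x_0,y_0$ be nonzero real numbers and $\varphi_x,\varphi_y\in\mathbb{R}$. Put $$\varphi_0=\frac{q\varphi_x-p\varphi_y}{\pi}.$$ Consider the Type I and Type II formations of $N$ satellites with these parameters, and the balance condition A, the no-collision condition B and the origin-avoidance condition C (all defined in the context). Then: a) For a Type I formation, condition A is fulfilled if and only if neither $p$ nor $q$ is divisible by $N$. For a Type II formation, condition A is fulfilled for all $N$. b) For a Type I formation, condition B is fulfilled if and only if the number $\varphi_0+(p-q)/2$ is not an integer and $N$ is co-prime with $p$ and with $q$. c) For a Type II formation with $N\ge 3$, condition B is fulfilled if and only if $\left(\varphi_0+(p-q)/2\right)N$ is not divisible by (i.e. is not an integer multiple of) the greatest common divisor of $N$ and $q-p$. For a Type II formation with $N=2$, condition B is fulfilled if and only if $\varphi_0$ is not an integer. d) The Lissajous curve $x=x_0\sin(2\pi p\tau+\varphi_x)$, $y=y_0\sin(2\pi q\tau+\varphi_y)$, $\tau\in\mathbb{R}$, goes through the origin $(0,0)$ if and only if $\varphi_0$ is an integer. Consequently, a Type I formation satisfies condition C if and only if $\varphi_0$ is not an integer. A Type II formation satisfies condition C if and only if $\varphi_0$ is not of the form $a+2b(q-p)/N$ with integers $a,b$.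
   Context: A formation is a family of $N$ planar trajectories $\tau\mapsto(x_i(\tau),y_i(\tau))$, $i=1,\dots,N$, $\tau\in\mathbb{R}$ (the projections of $N$ deputy satellites to the horizontal plane, in non-dimensional time $\tau$). Type I formation: $$x_i(\tau)=x_0\sin\left[2\pi p\left(\tau+\tfrac{i}{N}\right)+\varphi_x\right],\qquad y_i(\tau)=y_0\sin\left[2\pi q\left(\tau+\tfrac{i}{N}\right)+\varphi_y\right],\qquad i=1,\dots,N.$$ Type II formation: $$x_i(\tau)=x_0\sin\left[2\pi\left(p\tau+\tfrac{i}{N}\right)+\varphi_x\right],\qquad y_i(\tau)=y_0\sin\left[2\pi\left(q\tau+\tfrac{i}{N}\right)+\varphi_y\right],\qquad i=1,\dots,N.$$ In both types the phases $\varphi_x,\varphi_y$ are the same for all satellites. Condition A (balance): $\frac1N\sum_{k=1}^N x_k(\tau)=\frac1N\sum_{k=1}^N y_k(\tau)=0$ for all $\tau$. Condition B (no collision): $(x_i(\tau),y_i(\tau))\ne(x_j(\tau),y_j(\tau))$ for all $\tau$ and all $i\ne j$. Condition C: $(x_i(\tau),y_i(\tau))\ne(0,0)$ for all $i$ and all $\tau$. *)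

(* Defs.v *)
From Stdlib Require Import Reals ZArith Arith.
Open Scope R_scope.

(* [X i tau] is the position of satellite [i] at time [tau]; only the indices
   [1 <= i <= N] are meaningful. *)
Definition formation := nat -> R -> R * R.

Definition type_I (p q N : nat) (x0 y0 phix phiy : R) : formation :=
  fun i tau =>
    (x0 * sin (2 * PI * INR p * (tau + INR i / INR N) + phix),
     y0 * sin (2 * PI * INR q * (tau + INR i / INR N) + phiy)).

Definition type_II (p q N : nat) (x0 y0 phix phiy : R) : formation :=
  fun i tau =>
    (x0 * sin (2 * PI * (INR p * tau + INR i / INR N) + phix),
     y0 * sin (2 * PI * (INR q * tau + INR i / INR N) + phiy)).

Definition lissajous (p q : nat) (x0 y0 phix phiy : R) (tau : R) : R * R :=
  (x0 * sin (2 * PI * INR p * tau + phix),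
   y0 * sin (2 * PI * INR q * tau + phiy)).

Definition balanced (N : nat) (X : formation) : Prop :=
  forall tau : R,
    1 / INR N * sum_f 1 N (fun k => fst (X k tau)) = 0 /\
    1 / INR N * sum_f 1 N (fun k => snd (X k tau)) = 0.

Definition collision_free (N : nat) (X : formation) : Prop :=
  forall (tau : R) (i j : nat),
    (1 <= i <= N)%nat -> (1 <= j <= N)%nat -> i <> j -> X i tau <> X j tau.

Definition avoids_origin (N : nat) (X : formation) : Prop :=
  forall (i : nat) (tau : R), (1 <= i <= N)%nat -> X i tau <> (0, 0).

Definition is_integer (r : R) : Prop := exists z : Z, r = IZR z.

Definition is_integer_multiple (r : R) (d : Z) : Prop :=
  exists k : Z, r = IZR k * IZR d.

Definition phase_offset (p q : nat) (phix phiy : R) : R :=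
  (INR q * phix - INR p * phiy) / PI.

(* Main.v *)
Require Import Defs.
From Stdlib Require Import Reals ZArith Arith Lra Lia.
Open Scope R_scope.

(** All four parts reduce to solving trigonometric equations whose solutions
    are congruences modulo 1, once angles are measured in units of [PI].

    Balance.  For a fixed time the coordinates of the [N] satellites are sines
    of an arithmetic progression of angles with step [2 * PI * m / N], where
    [m] is [p] or [q] for Type I and [1] for Type II.  Multiplying the sum by
    [2 * sin (PI * m / N)] makes it telescope to zero
    ([sum_sin_telescope]); the factor vanishes exactly when [N] divides [m],
    and then all the terms are equal, so that the sum is not identically zero.

    Collisions and the origin.  Satellites of both types move on a curve
    [orbit] that differs from satellite to satellite only by phase shifts [a]
    (in x) and [b] (in y).  Two sines agree when the angles differ by a
    multiple of a full turn or add up to half a turn modulo full turns, so for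
    each coordinate there are two ways to agree.  The first does not involve
    the time: it says that the difference of the two shifts is an integer, and
    when it holds for one coordinate the other one can be made to agree by
    choosing the time.  If both coordinates agree in the second way, the time
    solves two equations [p * t + u = m] and [q * t + v = n] with integers [m]
    and [n] at our disposal.  Eliminating [t] leaves
    [q * u - p * v = q * m - p * n], and by Bezout the right side is an
    arbitrary integer; this is [simultaneous_integrality].  The same lemma
    governs passing through the origin, where both angles have to be multiples
    of [PI].  This gives the criteria [orbits_meet] and [orbit_hits_origin].

    What remains is arithmetic of the shifts.  For Type I they are [p * i / N]
    and [q * i / N]: they cancel from [q * a - p * b], and a difference
    [p * (i - j) / N] can be an integer for [i <> j] exactly when [N] and [p]
    have a common factor.  For Type II both are [i / N]: the difference for
    [i <> j] is never an integer, and the condition involves [i + j],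
    which for [N >= 3] represents every residue class modulo [N]
    ([distinct_index_sum]), but for [N = 2] only takes the value 3. *)

(** * Integers among the reals *)

Lemma is_integer_add_IZR (r : R) (z : Z) :
  is_integer (r + IZR z) <-> is_integer r.
Proof.
  split; intros [k Hk].
  - exists (k - z)%Z. rewrite minus_IZR. lra.
  - exists (k + z)%Z. rewrite plus_IZR. lra.
Qed.

Lemma is_integer_div (a n : Z) :
  n <> 0%Z -> is_integer (IZR a / IZR n) <-> (n | a)%Z.
Proof.
  intros Hn. assert (Hn' : IZR n <> 0) by now apply not_0_IZR.
  split; intros [k Hk]; exists k.
  - apply eq_IZR. rewrite mult_IZR, <- Hk. now field.
  - rewrite Hk, mult_IZR. now field.
Qed.

Lemma divide_of_nat (a b : nat) :
  Nat.divide a b <-> (Z.of_nat a | Z.of_nat b)%Z.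
Proof.
  split.
  - intros [k ->]. exists (Z.of_nat k). lia.
  - intros [k Hk]. destruct a as [|a].
    + exists 0%nat. lia.
    + exists (Z.to_nat k). nia.
Qed.

Lemma gcd_of_nat (a b : nat) :
  Z.gcd (Z.of_nat a) (Z.of_nat b) = Z.of_nat (Nat.gcd a b).
Proof.
  apply Z.gcd_unique.
  - lia.
  - apply divide_of_nat, Nat.gcd_divide_l.
  - apply divide_of_nat, Nat.gcd_divide_r.
  - intros d Ha Hb.
    rewrite <- Z.divide_abs_l, <- Zabs2Nat.id_abs in *.
    apply divide_of_nat, Nat.gcd_greatest; now apply divide_of_nat.
Qed.

Lemma combination_of_gcd (a b c : Z) :
  (Z.gcd a b | c)%Z -> exists m n : Z, (a * m + b * n = c)%Z.
Proof.
  intros [k ->].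
  destruct (Z.gcd_bezout a b (Z.gcd a b) eq_refl) as [u [v Huv]].
  exists (k * u)%Z, (k * v)%Z. rewrite <- Huv. ring.
Qed.

(** Eliminating [t] gives [q * u - p * v = q * m - p * n], and Bezout makes the
    right side an arbitrary integer.  This is where the coprimality of the two
    frequencies enters. *)
Lemma simultaneous_integrality (p q : nat) (u v : R) :
  (0 < p)%nat -> Nat.gcd p q = 1%nat ->
  (exists t : R, is_integer (INR p * t + u) /\ is_integer (INR q * t + v)) <->
  is_integer (INR q * u - INR p * v).
Proof.
  intros hp hpq.
  assert (Hp : INR p <> 0) by (apply not_0_INR; lia).
  split.
  - intros [t [[m Hm] [n Hn]]].
    exists (Z.of_nat q * m - Z.of_nat p * n)%Z.
    rewrite minus_IZR, !mult_IZR, <- !INR_IZR_INZ, <- Hm, <- Hn. ring.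
  - intros [z Hz].
    destruct (combination_of_gcd (Z.of_nat q) (Z.of_nat p) z) as [m [n Hmn]].
    { rewrite Z.gcd_comm, gcd_of_nat, hpq. apply Z.divide_1_l. }
    apply (f_equal IZR) in Hmn.
    rewrite plus_IZR, !mult_IZR, <- !INR_IZR_INZ, <- Hz in Hmn.
    exists ((IZR m - u) / INR p). split.
    + exists m. now field.
    + exists (- n)%Z. rewrite opp_IZR.
      apply (Rmult_eq_reg_l (INR p)); [|assumption].
      replace (INR p * (INR q * ((IZR m - u) / INR p) + v))
        with (INR q * IZR m - (INR q * u - INR p * v)) by now field.
      rewrite <- Hmn. ring.
Qed.

(** * Trigonometric equations in units of PI *)

Lemma sin_eq_0_iff (r : R) : sin (PI * r) = 0 <-> is_integer r.
Proof.
  pose proof PI_neq0 as HPI.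
  split.
  - intros H. destruct (sin_eq_0_0 _ H) as [k Hk]. exists k.
    apply (Rmult_eq_reg_l PI); [rewrite Hk; ring | assumption].
  - intros [k ->]. apply sin_eq_0_1. exists k. ring.
Qed.

Lemma cos_eq_0_iff (r : R) : cos (PI * r) = 0 <-> is_integer (r - 1 / 2).
Proof.
  replace (cos (PI * r)) with (- sin (PI * (r - 1 / 2))).
  - rewrite <- sin_eq_0_iff. split; lra.
  - replace (PI * (r - 1 / 2)) with (- (PI / 2 - PI * r)) by field.
    rewrite sin_neg, sin_shift. ring.
Qed.

Lemma sin_eq_iff (r s : R) :
  sin (PI * r) = sin (PI * s) <->
  is_integer ((r - s) / 2) \/ is_integer ((r + s) / 2 - 1 / 2).
Proof.
  rewrite <- sin_eq_0_iff, <- cos_eq_0_iff.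
  assert (H : sin (PI * r) - sin (PI * s) =
              2 * cos (PI * ((r + s) / 2)) * sin (PI * ((r - s) / 2))).
  { rewrite form4.
    replace ((PI * r - PI * s) / 2) with (PI * ((r - s) / 2)) by field.
    replace ((PI * r + PI * s) / 2) with (PI * ((r + s) / 2)) by field.
    ring. }
  split.
  - intros E. replace (sin (PI * r) - sin (PI * s)) with 0 in H by lra.
    symmetry in H.
    destruct (Rmult_integral _ _ H) as [H'|H']; [right; lra | now left].
  - intros [E|E]; rewrite E in H; lra.
Qed.

(** * Sums of sines of angles in arithmetic progression *)

Lemma sum_f_1 (N : nat) (f : nat -> R) :
  sum_f 1 N f = sum_f_R0 (fun k => f (S k)) (N - 1).
Proof.
  unfold sum_f. apply sum_eq. intros i _. f_equal. lia.
Qed.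

Lemma sum_f_1_scal (N : nat) (c : R) (f : nat -> R) :
  sum_f 1 N (fun k => c * f k) = c * sum_f 1 N f.
Proof.
  rewrite !sum_f_1, scal_sum.
  apply sum_eq. intros i _. ring.
Qed.

Lemma sum_f_1_ext (N : nat) (f g : nat -> R) :
  (forall k, f k = g k) -> sum_f 1 N f = sum_f 1 N g.
Proof. intros H. unfold sum_f. apply sum_eq. intros i _. apply H. Qed.

(** Each product [2 * sin (h) * sin (a + 2 * k * h)] is the difference of the
    cosines at the two neighbouring half-steps. *)
Lemma sum_sin_telescope (N : nat) (a h : R) :
  (1 <= N)%nat ->
  2 * sin h * sum_f 1 N (fun k => sin (a + 2 * INR k * h)) =
  cos (a + h) - cos (a + (2 * INR N + 1) * h).
Proof.
  intros HN. rewrite sum_f_1.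
  assert (step : forall k, 2 * sin h * sin (a + 2 * INR k * h) =
            cos (a + 2 * INR k * h - h) - cos (a + 2 * INR k * h + h)).
  { intros k. rewrite (cos_minus _ h), (cos_plus _ h). ring. }
  destruct N as [|n]; [lia|]. replace (S n - 1)%nat with n by lia. clear HN.
  induction n as [|n IH].
  - cbn [sum_f_R0]. rewrite step. simpl INR.
    replace (a + 2 * 1 * h - h) with (a + h) by ring.
    replace (a + 2 * 1 * h + h) with (a + (2 * 1 + 1) * h) by ring.
    reflexivity.
  - cbn [sum_f_R0]. rewrite Rmult_plus_distr_l, IH, step.
    rewrite (S_INR (S n)).
    replace (a + 2 * (INR (S n) + 1) * h - h)
      with (a + (2 * INR (S n) + 1) * h) by ring.
    replace (a + 2 * (INR (S n) + 1) * h + h)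
      with (a + (2 * (INR (S n) + 1) + 1) * h) by ring.
    ring.
Qed.

Lemma sum_sin_not_divide (N m : nat) (a : R) :
  (1 <= N)%nat -> ~ Nat.divide N m ->
  sum_f 1 N (fun k => sin (a + 2 * INR k * (PI * (INR m / INR N)))) = 0.
Proof.
  intros HN Hm.
  assert (HN0 : INR N <> 0) by (apply not_0_INR; lia).
  pose proof (sum_sin_telescope N a (PI * (INR m / INR N)) HN) as H.
  (* The last cosine is the first one after [m] full turns. *)
  replace (a + (2 * INR N + 1) * (PI * (INR m / INR N)))
    with (a + PI * (INR m / INR N) + 2 * INR m * PI) in H by now field.
  rewrite cos_period, Rminus_diag in H.
  destruct (Rmult_integral _ _ H) as [H'|H']; [|exact H'].
  exfalso. apply Hm, divide_of_nat, is_integer_div; [lia|].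
  rewrite <- !INR_IZR_INZ. apply sin_eq_0_iff. lra.
Qed.

Lemma sum_sin_divide (N m : nat) (a : R) :
  (1 <= N)%nat -> Nat.divide N m ->
  sum_f 1 N (fun k => sin (a + 2 * INR k * (PI * (INR m / INR N)))) =
  INR N * sin a.
Proof.
  intros HN [d ->].
  assert (HN0 : INR N <> 0) by (apply not_0_INR; lia).
  rewrite (sum_f_1_ext _ _ (fun _ => sin a)).
  - rewrite sum_f_1, sum_cte.
    replace (S (N - 1)) with N by lia. ring.
  - intros k. rewrite mult_INR.
    replace (a + 2 * INR k * (PI * (INR d * INR N / INR N)))
      with (a + 2 * INR (k * d) * PI) by (rewrite mult_INR; now field).
    apply sin_period.
Qed.

Lemma sum_harmonic_zero_iff (N m : nat) (c phi : R) :
  (1 <= N)%nat -> (0 < m)%nat -> c <> 0 ->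
  (forall tau, sum_f 1 N (fun k =>
      c * sin (2 * PI * INR m * (tau + INR k / INR N) + phi)) = 0) <->
  ~ Nat.divide N m.
Proof.
  intros HN Hm Hc.
  assert (HN0 : INR N <> 0) by (apply not_0_INR; lia).
  assert (Hm0 : INR m <> 0) by (apply not_0_INR; lia).
  assert (E : forall tau, sum_f 1 N (fun k =>
      c * sin (2 * PI * INR m * (tau + INR k / INR N) + phi)) =
    c * sum_f 1 N (fun k => sin (2 * PI * INR m * tau + phi
                               + 2 * INR k * (PI * (INR m / INR N))))).
  { intros tau. rewrite <- sum_f_1_scal. apply sum_f_1_ext.
    intros k. do 2 f_equal. now field. }
  split.
  - (* When [N] divides [m] the sum is [c * N] times a single sine, which is 1
       at this time. *)
    intros H Hd. specialize (H ((PI / 2 - phi) / (2 * PI * INR m))).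
    rewrite E, sum_sin_divide in H by assumption.
    replace (2 * PI * INR m * ((PI / 2 - phi) / (2 * PI * INR m)) + phi)
      with (PI / 2) in H by (field; split; [assumption | apply PI_neq0]).
    rewrite sin_PI2 in H.
    destruct (Rmult_integral _ _ H) as [|]; lra.
  - intros Hd tau. rewrite E, sum_sin_not_divide by assumption. ring.
Qed.

(** * Balance *)

Lemma mean_zero_iff (N : nat) (s : R) :
  (1 <= N)%nat -> 1 / INR N * s = 0 <-> s = 0.
Proof.
  intros HN. assert (HN0 : INR N <> 0) by (apply not_0_INR; lia).
  split; intros H.
  - replace s with (INR N * (1 / INR N * s)) by now field.
    rewrite H. ring.
  - rewrite H. ring.
Qed.

Lemma type_I_balanced (p q N : nat) (x0 y0 phix phiy : R) :
  (0 < p)%nat -> (0 < q)%nat -> (1 <= N)%nat -> x0 <> 0 -> y0 <> 0 ->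
  balanced N (type_I p q N x0 y0 phix phiy) <->
  ~ Nat.divide N p /\ ~ Nat.divide N q.
Proof.
  intros hp hq HN hx0 hy0.
  rewrite <- (sum_harmonic_zero_iff N p x0 phix) by assumption.
  rewrite <- (sum_harmonic_zero_iff N q y0 phiy) by assumption.
  unfold balanced, type_I. cbn [fst snd]. split.
  - intros H. split; intros tau; destruct (H tau) as [Hx Hy];
      now apply mean_zero_iff in Hx, Hy.
  - intros [Hx Hy] tau. split; now apply mean_zero_iff.
Qed.

Lemma type_II_balanced (p q N : nat) (x0 y0 phix phiy : R) :
  (2 <= N)%nat -> balanced N (type_II p q N x0 y0 phix phiy).
Proof.
  intros HN tau.
  assert (HN0 : INR N <> 0) by (apply not_0_INR; lia).
  assert (H : forall c m phi, sum_f 1 N (fun k =>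
      c * sin (2 * PI * (INR m * tau + INR k / INR N) + phi)) = 0).
  { intros c m phi. rewrite sum_f_1_scal.
    rewrite (sum_f_1_ext _ _ (fun k => sin (2 * PI * INR m * tau + phi
              + 2 * INR k * (PI * (INR 1 / INR N))))).
    - rewrite sum_sin_not_divide; [ring | lia |].
      intros Hd%Nat.divide_1_r. lia.
    - intros k. f_equal. simpl. now field. }
  unfold type_II. cbn [fst snd]. split; apply mean_zero_iff, H; lia.
Qed.

(** * Phase-shifted Lissajous curves *)

(** The common shape of [type_I], [type_II] and [lissajous]: the shifts [a] and
    [b], counted in full turns, are all that distinguishes two satellites. *)
Definition orbit (p q : nat) (x0 y0 phix phiy a b tau : R) : R * R :=
  (x0 * sin (2 * PI * (INR p * tau + a) + phix),
   y0 * sin (2 * PI * (INR q * tau + b) + phiy)).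

Lemma type_I_orbit (p q N : nat) (x0 y0 phix phiy : R) (i : nat) (tau : R) :
  type_I p q N x0 y0 phix phiy i tau =
  orbit p q x0 y0 phix phiy
    (INR p * INR i / INR N) (INR q * INR i / INR N) tau.
Proof.
  unfold type_I, orbit. f_equal; do 2 f_equal; unfold Rdiv; ring.
Qed.

Lemma lissajous_orbit (p q : nat) (x0 y0 phix phiy tau : R) :
  lissajous p q x0 y0 phix phiy tau = orbit p q x0 y0 phix phiy 0 0 tau.
Proof. unfold lissajous, orbit. f_equal; do 2 f_equal; ring. Qed.

Lemma scaled_sin_eq_0_iff (c m tau a phi : R) :
  c <> 0 ->
  c * sin (2 * PI * (m * tau + a) + phi) = 0 <->
  is_integer (m * (2 * tau) + (2 * a + phi / PI)).
Proof.
  intros Hc. rewrite <- sin_eq_0_iff.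
  replace (PI * (m * (2 * tau) + (2 * a + phi / PI)))
    with (2 * PI * (m * tau + a) + phi) by (field; apply PI_neq0).
  split; intros H.
  - now destruct (Rmult_integral _ _ H).
  - rewrite H. ring.
Qed.

Lemma scaled_sin_eq_iff (c m tau a a' phi : R) :
  c <> 0 ->
  c * sin (2 * PI * (m * tau + a) + phi) =
  c * sin (2 * PI * (m * tau + a') + phi) <->
  is_integer (a - a') \/
  is_integer (m * (2 * tau) + (a + a' + phi / PI - 1 / 2)).
Proof.
  intros Hc. pose proof PI_neq0 as HPI.
  replace (2 * PI * (m * tau + a) + phi)
    with (PI * (2 * (m * tau + a) + phi / PI)) by now field.
  replace (2 * PI * (m * tau + a') + phi)
    with (PI * (2 * (m * tau + a') + phi / PI)) by now field.
  replace (a - a') with ((2 * (m * tau + a) + phi / PI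
                          - (2 * (m * tau + a') + phi / PI)) / 2)
    by now field.
  replace (m * (2 * tau) + (a + a' + phi / PI - 1 / 2))
    with ((2 * (m * tau + a) + phi / PI
           + (2 * (m * tau + a') + phi / PI)) / 2 - 1 / 2) by now field.
  rewrite <- sin_eq_iff. split; intros H.
  - now apply Rmult_eq_reg_l in H.
  - now rewrite H.
Qed.

Lemma exists_double_time (P : R -> Prop) :
  (exists tau, P (2 * tau)) <-> exists t, P t.
Proof.
  split.
  - intros [tau H]. now exists (2 * tau).
  - intros [t H]. exists (t / 2). now replace (2 * (t / 2)) with t by field.
Qed.

Lemma linear_integrality_solvable (m : nat) (u : R) :
  (0 < m)%nat -> exists t, is_integer (INR m * t + u).
Proof.
  intros Hm. assert (INR m <> 0) by (apply not_0_INR; lia).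
  exists (- u / INR m), 0%Z. now field.
Qed.

Lemma orbit_hits_origin (p q : nat) (x0 y0 phix phiy a b : R) :
  (0 < p)%nat -> Nat.gcd p q = 1%nat -> x0 <> 0 -> y0 <> 0 ->
  (exists tau, orbit p q x0 y0 phix phiy a b tau = (0, 0)) <->
  is_integer (phase_offset p q phix phiy + 2 * (INR q * a - INR p * b)).
Proof.
  intros hp hpq hx0 hy0.
  replace (phase_offset p q phix phiy + 2 * (INR q * a - INR p * b))
    with (INR q * (2 * a + phix / PI) - INR p * (2 * b + phiy / PI))
    by (unfold phase_offset; field; apply PI_neq0).
  rewrite <- simultaneous_integrality by assumption.
  etransitivity; [|apply exists_double_time]. cbv beta.
  split; intros [tau H]; exists tau.
  - injection H as Hx Hy.
    split; [apply (scaled_sin_eq_0_iff x0) | apply (scaled_sin_eq_0_iff y0)];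
      assumption.
  - unfold orbit. f_equal; now apply scaled_sin_eq_0_iff.
Qed.

(** An integer difference of shifts makes one coordinate agree at all times,
    and the other one then agrees at a suitable time; otherwise in both
    coordinates the two angles add up to half a turn modulo full turns, and
    [simultaneous_integrality] applies. *)
Lemma orbits_meet (p q : nat) (x0 y0 phix phiy a b a' b' : R) :
  (0 < p)%nat -> (0 < q)%nat -> Nat.gcd p q = 1%nat -> x0 <> 0 -> y0 <> 0 ->
  (exists tau, orbit p q x0 y0 phix phiy a b tau =
               orbit p q x0 y0 phix phiy a' b' tau) <->
  is_integer (a - a') \/ is_integer (b - b') \/
  is_integer (phase_offset p q phix phiy + (INR p - INR q) / 2
              + (INR q * (a + a') - INR p * (b + b'))).
Proof.
  intros hp hq hpq hx0 hy0.
  set (u := a + a' + phix / PI - 1 / 2).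
  set (v := b + b' + phiy / PI - 1 / 2).
  replace (phase_offset p q phix phiy + (INR p - INR q) / 2
              + (INR q * (a + a') - INR p * (b + b')))
    with (INR q * u - INR p * v)
    by (unfold phase_offset, u, v; field; apply PI_neq0).
  rewrite <- simultaneous_integrality by assumption.
  transitivity (exists t, (is_integer (a - a') \/ is_integer (INR p * t + u)) /\
                          (is_integer (b - b') \/ is_integer (INR q * t + v))).
  - etransitivity; [|apply exists_double_time]. cbv beta.
    split; intros [tau H]; exists tau.
    + injection H as Hx Hy.
      split; [apply (scaled_sin_eq_iff x0) | apply (scaled_sin_eq_iff y0)];
        assumption.
    + unfold orbit. f_equal; now apply scaled_sin_eq_iff.
  - split.
    + intros [t [[Hx|Hx] [Hy|Hy]]]; eauto.
    + intros [Hx|[Hy|[t [Hx Hy]]]]; [| |eauto].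
      * destruct (linear_integrality_solvable q v hq) as [t Ht]; eauto.
      * destruct (linear_integrality_solvable p u hp) as [t Ht]; eauto.
Qed.

(** * Avoiding the origin *)

Lemma lissajous_hits_origin (p q : nat) (x0 y0 phix phiy : R) :
  (0 < p)%nat -> Nat.gcd p q = 1%nat -> x0 <> 0 -> y0 <> 0 ->
  (exists tau, lissajous p q x0 y0 phix phiy tau = (0, 0)) <->
  is_integer (phase_offset p q phix phiy).
Proof.
  intros hp hpq hx0 hy0.
  pose proof (orbit_hits_origin p q x0 y0 phix phiy 0 0 hp hpq hx0 hy0) as H.
  replace (phase_offset p q phix phiy + 2 * (INR q * 0 - INR p * 0))
    with (phase_offset p q phix phiy) in H by ring.
  rewrite <- H. split; intros [tau E]; exists tau;
    [rewrite <- lissajous_orbit | rewrite lissajous_orbit]; exact E.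
Qed.

Lemma type_I_avoids_origin (p q N : nat) (x0 y0 phix phiy : R) :
  (0 < p)%nat -> Nat.gcd p q = 1%nat -> (1 <= N)%nat -> x0 <> 0 -> y0 <> 0 ->
  avoids_origin N (type_I p q N x0 y0 phix phiy) <->
  ~ is_integer (phase_offset p q phix phiy).
Proof.
  intros hp hpq HN hx0 hy0.
  assert (H : forall i,
    (exists tau, type_I p q N x0 y0 phix phiy i tau = (0, 0)) <->
    is_integer (phase_offset p q phix phiy)).
  { intros i.
    pose proof (orbit_hits_origin p q x0 y0 phix phiy
      (INR p * INR i / INR N) (INR q * INR i / INR N) hp hpq hx0 hy0) as H.
    replace (phase_offset p q phix phiy + 2 *
        (INR q * (INR p * INR i / INR N) - INR p * (INR q * INR i / INR N)))
      with (phase_offset p q phix phiy) in H by (unfold Rdiv; ring).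
    rewrite <- H. split; intros [tau E]; exists tau;
      [rewrite <- type_I_orbit | rewrite type_I_orbit]; exact E. }
  split.
  - intros HA Hz. apply (H 1%nat) in Hz. destruct Hz as [tau Hz].
    apply (HA 1%nat tau); [lia | exact Hz].
  - intros Hn i tau _ E. apply Hn, (H i). now exists tau.
Qed.

Lemma residue_representative (N : nat) (z : Z) :
  (1 <= N)%nat ->
  exists (i : nat) (k : Z), (1 <= i <= N)%nat /\
    z = (Z.of_nat i + k * Z.of_nat N)%Z.
Proof.
  intros HN.
  pose proof (Z.mod_pos_bound (z - 1) (Z.of_nat N) ltac:(lia)) as Hb.
  pose proof (Z.div_mod (z - 1) (Z.of_nat N) ltac:(lia)) as Hd.
  exists (Z.to_nat ((z - 1) mod Z.of_nat N + 1)), ((z - 1) / Z.of_nat N)%Z.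
  split; lia.
Qed.

Lemma type_II_avoids_origin (p q N : nat) (x0 y0 phix phiy : R) :
  (0 < p)%nat -> Nat.gcd p q = 1%nat -> (1 <= N)%nat -> x0 <> 0 -> y0 <> 0 ->
  avoids_origin N (type_II p q N x0 y0 phix phiy) <->
  ~ exists a b : Z, phase_offset p q phix phiy =
                    IZR a + 2 * IZR b * (INR q - INR p) / INR N.
Proof.
  intros hp hpq HN hx0 hy0.
  assert (HN0 : INR N <> 0) by (apply not_0_INR; lia).
  assert (H : forall i,
    (exists tau, type_II p q N x0 y0 phix phiy i tau = (0, 0)) <->
    is_integer (phase_offset p q phix phiy
      + 2 * (INR q * (INR i / INR N) - INR p * (INR i / INR N)))).
  { intros i. exact (orbit_hits_origin _ _ _ _ _ _ _ _ hp hpq hx0 hy0). }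
  split.
  - intros HA [a [b E]].
    (* Replacing [- b] by its representative in [1..N] changes the right side
       by a multiple of [2 * (q - p)]. *)
    destruct (residue_representative N (- b) HN) as [i [k [Hi Hb]]].
    destruct (proj2 (H i)) as [tau Htau].
    + exists (a - 2 * k * (Z.of_nat q - Z.of_nat p))%Z.
      replace b with (- (Z.of_nat i + k * Z.of_nat N))%Z in E by lia.
      rewrite E.
      rewrite opp_IZR, plus_IZR, minus_IZR, !mult_IZR, minus_IZR.
      rewrite <- !INR_IZR_INZ. now field.
    + exact (HA i tau Hi Htau).
  - intros Hn i tau _ E. apply Hn.
    destruct (proj1 (H i) (ex_intro _ tau E)) as [a Ha].
    exists a, (- Z.of_nat i)%Z. rewrite <- Ha, opp_IZR, <- INR_IZR_INZ.
    now field.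
Qed.

(** * Collisions *)

Lemma index_shift_integer (m N i j : nat) :
  (1 <= N)%nat ->
  is_integer (INR m * INR i / INR N - INR m * INR j / INR N) <->
  (Z.of_nat N | Z.of_nat m * (Z.of_nat i - Z.of_nat j))%Z.
Proof.
  intros HN. assert (HN0 : INR N <> 0) by (apply not_0_INR; lia).
  rewrite <- is_integer_div by lia.
  replace (IZR (Z.of_nat m * (Z.of_nat i - Z.of_nat j)) / IZR (Z.of_nat N))
    with (INR m * INR i / INR N - INR m * INR j / INR N).
  - reflexivity.
  - rewrite mult_IZR, minus_IZR, <- !INR_IZR_INZ. now field.
Qed.

Lemma coprime_index_shift (m N i j : nat) :
  Nat.gcd N m = 1%nat -> (1 <= i <= N)%nat -> (1 <= j <= N)%nat ->
  (Z.of_nat N | Z.of_nat m * (Z.of_nat i - Z.of_nat j))%Z -> i = j.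
Proof.
  intros Hg Hi Hj Hd. apply Z.gauss in Hd.
  - destruct Hd as [k Hk].
    assert (k = 0)%Z by nia. subst k. lia.
  - now rewrite gcd_of_nat, Hg.
Qed.

(** With a common divisor [d > 1] of [N] and [m], indices [N / d] apart have
    shifts that differ by [m / d] turns. *)
Lemma not_coprime_index_shift (m N : nat) :
  (1 <= N)%nat -> Nat.gcd N m <> 1%nat ->
  exists i : nat, (2 <= i <= N)%nat /\
    (Z.of_nat N | Z.of_nat m * (Z.of_nat i - Z.of_nat 1))%Z.
Proof.
  intros HN Hg. set (d := Nat.gcd N m) in *.
  destruct (Nat.gcd_divide_l N m) as [c Hc]. fold d in Hc.
  destruct (Nat.gcd_divide_r N m) as [e He]. fold d in He.
  clearbody d.
  assert (Hd : (2 <= d)%nat) by (destruct d as [|[|d]]; lia).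
  assert (Hc0 : (1 <= c)%nat) by (destruct c; lia).
  exists (S c). split.
  - nia.
  - exists (Z.of_nat e). rewrite Hc, He. lia.
Qed.

Lemma type_I_collision_free (p q N : nat) (x0 y0 phix phiy : R) :
  (0 < p)%nat -> (0 < q)%nat -> Nat.gcd p q = 1%nat -> (2 <= N)%nat ->
  x0 <> 0 -> y0 <> 0 ->
  collision_free N (type_I p q N x0 y0 phix phiy) <->
  ~ is_integer (phase_offset p q phix phiy + (INR p - INR q) / 2) /\
  Nat.gcd N p = 1%nat /\ Nat.gcd N q = 1%nat.
Proof.
  intros hp hq hpq HN hx0 hy0.
  assert (H : forall i j,
    (exists tau, type_I p q N x0 y0 phix phiy i tau =
                 type_I p q N x0 y0 phix phiy j tau) <->
    (Z.of_nat N | Z.of_nat p * (Z.of_nat i - Z.of_nat j))%Z \/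
    (Z.of_nat N | Z.of_nat q * (Z.of_nat i - Z.of_nat j))%Z \/
    is_integer (phase_offset p q phix phiy + (INR p - INR q) / 2)).
  { intros i j.
    pose proof (orbits_meet p q x0 y0 phix phiy
      (INR p * INR i / INR N) (INR q * INR i / INR N)
      (INR p * INR j / INR N) (INR q * INR j / INR N) hp hq hpq hx0 hy0) as H.
    rewrite !index_shift_integer in H by lia.
    match type of H with context [?A + (?B - ?C)] =>
      replace (A + (B - C)) with A in H by (unfold Rdiv; ring) end.
    rewrite <- H. split; intros [tau E]; exists tau;
      [rewrite <- !type_I_orbit | rewrite !type_I_orbit]; exact E. }
  split.
  - intros HC.
    assert (HC' : forall i j, (1 <= i <= N)%nat -> (1 <= j <= N)%nat ->
      i <> j -> ~ exists tau, type_I p q N x0 y0 phix phiy i tau =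
                              type_I p q N x0 y0 phix phiy j tau).
    { intros i j Hi Hj Hij [tau E]. exact (HC tau i j Hi Hj Hij E). }
    split; [|split].
    + intros Hz. apply (HC' 1%nat 2%nat); try lia. apply H. now right; right.
    + destruct (Nat.eq_dec (Nat.gcd N p) 1) as [|Hg]; [assumption|exfalso].
      destruct (not_coprime_index_shift p N) as [i [Hi Hd]]; [lia|assumption|].
      apply (HC' i 1%nat); try lia. apply H. now left.
    + destruct (Nat.eq_dec (Nat.gcd N q) 1) as [|Hg]; [assumption|exfalso].
      destruct (not_coprime_index_shift q N) as [i [Hi Hd]]; [lia|assumption|].
      apply (HC' i 1%nat); try lia. apply H. now right; left.
  - intros [Hz [Hp Hq]] tau i j Hi Hj Hij E.
    destruct (proj1 (H i j) (ex_intro _ tau E)) as [Hd|[Hd|Hd]].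
    + exact (Hij (coprime_index_shift _ _ _ _ Hp Hi Hj Hd)).
    + exact (Hij (coprime_index_shift _ _ _ _ Hq Hi Hj Hd)).
    + exact (Hz Hd).
Qed.

Lemma type_II_collision_iff (p q N : nat) (x0 y0 phix phiy : R) (i j : nat) :
  (0 < p)%nat -> (0 < q)%nat -> Nat.gcd p q = 1%nat ->
  x0 <> 0 -> y0 <> 0 ->
  (1 <= i <= N)%nat -> (1 <= j <= N)%nat -> i <> j ->
  (exists tau, type_II p q N x0 y0 phix phiy i tau =
               type_II p q N x0 y0 phix phiy j tau) <->
  is_integer (phase_offset p q phix phiy + (INR p - INR q) / 2
              + INR (i + j) * (INR q - INR p) / INR N).
Proof.
  intros hp hq hpq hx0 hy0 Hi Hj Hij.
  assert (HN0 : INR N <> 0) by (apply not_0_INR; lia).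
  assert (Hd : ~ is_integer (INR i / INR N - INR j / INR N)).
  { intros Hd. apply Hij, (coprime_index_shift 1 N i j); try assumption.
    - now rewrite Nat.gcd_comm.
    - apply index_shift_integer; [lia|]. simpl INR. now rewrite !Rmult_1_l. }
  pose proof (orbits_meet p q x0 y0 phix phiy
    (INR i / INR N) (INR i / INR N) (INR j / INR N) (INR j / INR N)
    hp hq hpq hx0 hy0) as H.
  match type of H with context [?A + (INR q * ?B - ?C)] =>
    replace (A + (INR q * B - C))
      with (A + INR (i + j) * (INR q - INR p) / INR N) in H
      by (rewrite plus_INR; now field) end.
  unfold orbit in H. unfold type_II. rewrite H. tauto.
Qed.

(** The sums of two distinct indices are the integers from 3 to [2 * N - 1],
    which include [N] consecutive ones as soon as [N >= 3]. *)
Lemma distinct_index_sum (N : nat) (z : Z) :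
  (3 <= N)%nat ->
  exists (i j : nat) (k : Z), (1 <= i <= N)%nat /\ (1 <= j <= N)%nat /\
    i <> j /\ z = (Z.of_nat (i + j) + k * Z.of_nat N)%Z.
Proof.
  intros HN.
  destruct (residue_representative N (z - 2)) as [s [k [Hs Hz]]]; [lia|].
  (* Here [s + 2], between 3 and [N + 2], is the sum to be reached. *)
  destruct (Nat.le_gt_cases (s + 1) N) as [Hle|Hgt].
  - exists (s + 1)%nat, 1%nat, k. lia.
  - exists N, 2%nat, k. lia.
Qed.

Lemma type_II_collision_free (p q N : nat) (x0 y0 phix phiy : R) :
  (0 < p)%nat -> (0 < q)%nat -> Nat.gcd p q = 1%nat -> (3 <= N)%nat ->
  x0 <> 0 -> y0 <> 0 ->
  collision_free N (type_II p q N x0 y0 phix phiy) <->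
  ~ is_integer_multiple
      ((phase_offset p q phix phiy + (INR p - INR q) / 2) * INR N)
      (Z.gcd (Z.of_nat N) (Z.of_nat q - Z.of_nat p)).
Proof.
  intros hp hq hpq HN hx0 hy0.
  assert (HN0 : INR N <> 0) by (apply not_0_INR; lia).
  set (c := phase_offset p q phix phiy + (INR p - INR q) / 2).
  set (D := (Z.of_nat q - Z.of_nat p)%Z).
  assert (HD : INR q - INR p = IZR D)
    by (unfold D; rewrite minus_IZR, <- !INR_IZR_INZ; reflexivity).
  split.
  - intros HC [l Hl].
    destruct (combination_of_gcd (Z.of_nat N) D (l * Z.gcd (Z.of_nat N) D))
      as [m [n Hmn]]; [apply Z.divide_factor_r|].
    (* [c * N = N * m + D * n], and [- n] is congruent to some [i + j]. *)
    destruct (distinct_index_sum N (- n) HN) as [i [j [k [Hi [Hj [Hij Hn]]]]]].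
    destruct (proj2 (type_II_collision_iff p q N x0 y0 phix phiy i j
                       hp hq hpq hx0 hy0 Hi Hj Hij)) as [tau E].
    + fold c. exists (m - k * D)%Z. rewrite HD.
      apply (Rmult_eq_reg_r (INR N)); [|assumption].
      rewrite Rmult_plus_distr_r, Hl, <- mult_IZR, <- Hmn.
      replace n with (- (Z.of_nat (i + j) + k * Z.of_nat N))%Z by lia.
      rewrite plus_IZR, minus_IZR, !mult_IZR, opp_IZR, plus_IZR, mult_IZR.
      rewrite <- !INR_IZR_INZ. now field.
    + exact (HC tau i j Hi Hj Hij E).
  - intros Hn tau i j Hi Hj Hij E. apply Hn.
    destruct (proj1 (type_II_collision_iff p q N x0 y0 phix phiy i j
                       hp hq hpq hx0 hy0 Hi Hj Hij) (ex_intro _ tau E))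
      as [m Hm]. fold c in Hm. rewrite HD in Hm.
    assert (Hdiv : (Z.gcd (Z.of_nat N) D
                    | m * Z.of_nat N - Z.of_nat (i + j) * D)%Z).
    { apply Z.divide_sub_r; apply Z.divide_mul_r;
        [apply Z.gcd_divide_l | apply Z.gcd_divide_r]. }
    destruct Hdiv as [l Hl]. exists l. rewrite <- mult_IZR, <- Hl.
    rewrite minus_IZR, !mult_IZR, <- !INR_IZR_INZ, <- Hm. now field.
Qed.

(** The only index sum is 3, and [(p - q) / 2 + 3 * (q - p) / 2] is the integer
    [q - p]. *)
Lemma type_II_collision_free_two (p q : nat) (x0 y0 phix phiy : R) :
  (0 < p)%nat -> (0 < q)%nat -> Nat.gcd p q = 1%nat -> x0 <> 0 -> y0 <> 0 ->
  collision_free 2 (type_II p q 2 x0 y0 phix phiy) <->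
  ~ is_integer (phase_offset p q phix phiy).
Proof.
  intros hp hq hpq hx0 hy0.
  assert (H : forall i j, (1 <= i <= 2)%nat -> (1 <= j <= 2)%nat -> i <> j ->
    (exists tau, type_II p q 2 x0 y0 phix phiy i tau =
                 type_II p q 2 x0 y0 phix phiy j tau) <->
    is_integer (phase_offset p q phix phiy)).
  { intros i j Hi Hj Hij. rewrite type_II_collision_iff by assumption.
    replace (i + j)%nat with 3%nat by lia.
    rewrite <- (is_integer_add_IZR (phase_offset p q phix phiy)
                  (Z.of_nat q - Z.of_nat p)).
    rewrite minus_IZR, <- !INR_IZR_INZ.
    match goal with |- is_integer ?A <-> is_integer ?B =>
      replace A with B by (simpl INR; field) end.
    reflexivity. }
  split.
  - intros HC Hz. apply (H 1%nat 2%nat) in Hz; try lia.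
    destruct Hz as [tau E]. apply (HC tau 1%nat 2%nat); [lia..|exact E].
  - intros Hn tau i j Hi Hj Hij E. apply Hn, (H i j); try assumption.
    now exists tau.
Qed.

Theorem proposition1 (p q N : nat) (x0 y0 phix phiy : R)
    (hp : (0 < p)%nat) (hq : (0 < q)%nat) (hpq : Nat.gcd p q = 1%nat)
    (hN : (2 <= N)%nat) (hx0 : x0 <> 0) (hy0 : y0 <> 0) :
  let phi0 := phase_offset p q phix phiy in
  let XI := type_I p q N x0 y0 phix phiy in
  let XII := type_II p q N x0 y0 phix phiy in
  (* a *)
  ((balanced N XI <-> ~ Nat.divide N p /\ ~ Nat.divide N q) /\
   balanced N XII) /\
  (* b *)
  (collision_free N XI <->
     ~ is_integer (phi0 + (INR p - INR q) / 2) /\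
     Nat.gcd N p = 1%nat /\ Nat.gcd N q = 1%nat) /\
  (* c *)
  (((3 <= N)%nat ->
      (collision_free N XII <->
         ~ is_integer_multiple ((phi0 + (INR p - INR q) / 2) * INR N)
             (Z.gcd (Z.of_nat N) (Z.of_nat q - Z.of_nat p)))) /\
   (N = 2%nat -> (collision_free N XII <-> ~ is_integer phi0))) /\
  (* d *)
  (((exists tau : R, lissajous p q x0 y0 phix phiy tau = (0, 0)) <->
      is_integer phi0) /\
   (avoids_origin N XI <-> ~ is_integer phi0) /\
   (avoids_origin N XII <->
      ~ exists a b : Z,
          phi0 = IZR a + 2 * IZR b * (INR q - INR p) / INR N)).
Proof.
  intros phi0 XI XII.
  assert (hN1 : (1 <= N)%nat) by lia.
  split; [|split; [|split]].
  - split; [now apply type_I_balanced | now apply type_II_balanced].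
  - now apply type_I_collision_free.
  - split.
    + intros hN3. now apply type_II_collision_free.
    + intros hN2. unfold XII. rewrite hN2.
      now apply type_II_collision_free_two.
  - split; [|split].
    + now apply lissajous_hits_origin.
    + now apply type_I_avoids_origin.
    + now apply type_II_avoids_origin.
Qed.
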